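(* Let $G$ be a connected Lie group, $H$ a closed subgroup, and let $F=\dfrac{(\alpha+\beta)^2}{\alpha}$ be a $G$-invariant square metric on $G/H$, where $\alpha$ is a Riemannian metric and $\beta$ a 1-form on $G/H$. Let $X$ be the vector field on $G/H$ corresponding to the 1-form $\beta$. Then $\alpha$ is a $G$-invariant Riemannian metric and the vector field $X$ is also $G$-invariant.
   Context: A Minkowski norm on a finite-dimensional real vector space $V$ is a function $F:V\to[0,\infty)$ that is smooth on $V\setminus\{0\}$, satisfies $F(\lambda v)=\lambda F(v)$ for all $\lambda>0$, and whose Hessian $g_{ij}(y)=\frac12 (F^2)_{y^iy^j}$ is positive definite at every $y\neq 0$. A Finsler metric on a connected smooth manifold $M$ is a function $F:TM\to[0,\infty)$, smooth on $TM\setminus\{0\}$, whose restriction to each $T_xM$ is a Minkowski norm. For a Riemannian metric one writes $\alpha(x,y)=\sqrt{a_{ij}(x)y^iy^j}$, and a 1-form is written $\beta(x,y)=b_i(x)y^i$. A square metric is a Finsler metric of the form $F=(\alpha+\beta)^2/\alpha$. The vector field $X$ corresponding to $\beta$ is $X|_x=b^i\frac{\partial}{\partial x^i}$ with $b^i=a^{ij}b_j$, i.e. $\langle X|_x,y\rangle=\beta(x,y)$ for all $y\in T_xM$, where $\langle\,,\,\rangle$ is the inner product induced by $\alpha$. $G$ acts on $G/H$ by left translations; a metric ($F$ or $\alpha$) is $G$-invariant if every element of $G$ acts by an isometry, and $X$ is $G$-invariant if it is preserved by the differential of the action of every element of $G$. *)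

(* Defs.v *)
From HB Require Import structures.
From mathcomp Require Import all_boot all_order all_algebra.
From mathcomp Require Import all_classical all_reals all_analysis.

Set Implicit Arguments.
Unset Strict Implicit.
Unset Printing Implicit Defensive.

Import Order.TTheory GRing.Theory Num.Theory.
Import numFieldNormedType.Exports.

Local Open Scope classical_set_scope.
Local Open Scope ring_scope.
Local Open Scope quotient_scope.

(* [f] is C^k on the open set [U]: all iterated directional derivatives up to
   order [k] exist and are continuous.  Only used with [V] and [W] of finite
   dimension. *)
Fixpoint Ck_on (R : realType) (V W : normedModType R) (k : nat)
    (U : set V) (f : V -> W) : Prop :=
  if k is k'.+1 then
    (forall x, U x -> differentiable f x) /\
    (forall v, Ck_on k' U (fun x => 'D_v f x))
  else forall x, U x -> {for x, continuous f}.

Definition smooth_on (R : realType) (V W : normedModType R)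
    (U : set V) (f : V -> W) : Prop := forall k, Ck_on k U f.

Lemma diff_compE (R : realType) (U V W : normedModType R) (f : U -> V)
    (g : V -> W) (x u : U) (y : V) :
  f x = y -> differentiable f x -> differentiable g y ->
  'd (g \o f) x u = 'd g y ('d f x u).
Proof.
move=> <- df dg; exact: (congr1 (fun h : U -> W => h u) (diff_comp df dg)).
Qed.

Record chart (R : realType) (n : nat) (M : topologicalType) := Chart {
  chart_dom : set M;
  chart_cod : set 'rV[R]_n;
  chart_map :> M -> 'rV[R]_n;
  chart_inv : 'rV[R]_n -> M;
  open_chart_dom : open chart_dom;
  open_chart_cod : open chart_cod;
  chart_mapP : forall x, chart_dom x -> chart_cod (chart_map x);
  chart_invP : forall p, chart_cod p -> chart_dom (chart_inv p);
  chart_mapK : forall x, chart_dom x -> chart_inv (chart_map x) = x;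
  chart_invK : forall p, chart_cod p -> chart_map (chart_inv p) = p;
  chart_map_continuous : forall x, chart_dom x -> {for x, continuous chart_map};
  chart_inv_continuous : forall p, chart_cod p -> {for p, continuous chart_inv}
}.

(* The atlas need not be maximal. *)
Record manifold (R : realType) (n : nat) (M : topologicalType) := Manifold {
  atlas : set (chart R n M);
  atlas_cover : forall x : M, exists2 c, atlas c & chart_dom c x;
  atlas_smooth : forall c d, atlas c -> atlas d ->
    smooth_on [set p | chart_cod c p /\ chart_dom d (chart_inv c p)]
              (d \o chart_inv c);
  manifold_hausdorff : hausdorff_space M;
  manifold_second_countable : @second_countable M
}.

Section tangent.
Context {R : realType} {n : nat} {M : topologicalType} (S : manifold R n M).

Definition chart_at (x : M) (c : chart R n M) : Prop :=
  atlas S c /\ chart_dom c x.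

(* The derivative at [x] of the change of coordinates from [c] to [d]. *)
Definition transition (x : M) (c d : chart R n M) (u : 'rV[R]_n) : 'rV[R]_n :=
  'd (d \o chart_inv c) (c x) u.

(* A tangent vector at [x] is the family of its coordinates in the charts at
   [x], subject to the change-of-coordinates rule; the entries at the other
   charts carry no information and are set to 0. *)
Definition tangent_pred (x : M) : {pred (chart R n M -> 'rV[R]_n)} :=
  fun v => `[< (forall c, ~ chart_at x c -> v c = 0) /\
               (forall c d, chart_at x c -> chart_at x d ->
                  v d = transition x c d (v c)) >].

Lemma tangent_submod (x : M) : submod_closed (tangent_pred x).
Proof.
split.
  by apply/asboolP; split => // c d _ _; rewrite /transition linear0.
move=> k u v /asboolP[u0 uT] /asboolP[v0 vT]; apply/asboolP.
have uvE c : (k *: u + v) c = k *: u c + v c by [].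
split => [c cx|c d cx dx]; first by rewrite uvE u0// v0// scaler0 addr0.
by rewrite !uvE (uT c d)// (vT c d)// /transition linearP.
Qed.

HB.instance Definition _ (x : M) :=
  GRing.isSubmodClosed.Build R _ (tangent_pred x) (tangent_submod x).

Record tangent (x : M) := Tangent {
  tcoord :> chart R n M -> 'rV[R]_n;
  tcoordP : tcoord \in tangent_pred x }.

HB.instance Definition _ (x : M) := [isSub for @tcoord x].
HB.instance Definition _ (x : M) := [Choice of tangent x by <:].
HB.instance Definition _ (x : M) :=
  [SubChoice_isSubLmodule of tangent x by <:].

Lemma transition_id (x : M) (c : chart R n M) (u : 'rV[R]_n) :
  chart_at x c -> transition x c c u = u.
Proof.
move=> [cA cx]; have oc := @open_chart_cod _ _ _ c.
have cc := chart_mapP cx.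
have [/(_ (c x))+ _] := atlas_smooth cA cA 1%N.
move=> /(_ (conj cc (chart_invP cc))) dif.
rewrite /transition -deriveE//.
rewrite (@near_eq_derive _ _ _ _ id) ?derive_id//.
near=> p; rewrite /=; apply: chart_invK; near: p.
exact: open_nbhs_nbhs.
Unshelve. all: by end_near. Qed.

Lemma transition_trans (x : M) (c d e : chart R n M) (u : 'rV[R]_n) :
  chart_at x c -> chart_at x d -> chart_at x e ->
  transition x d e (transition x c d u) = transition x c e u.
Proof.
move=> [cA cx] [dA dx] [eA ex].
have cc := chart_mapP cx; have dd := chart_mapP dx.
have dif c1 d1 : atlas S c1 -> atlas S d1 -> chart_dom c1 x ->
    chart_dom d1 x -> differentiable (d1 \o chart_inv c1) (c1 x).
  move=> c1A d1A c1x d1x; have [+ _] := atlas_smooth c1A d1A 1%N; apply.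
  by split; [exact: chart_mapP|rewrite chart_mapK].
have ccx : (d \o chart_inv c) (c x) = d x by rewrite /= chart_mapK.
have dce := dif _ _ cA eA cx ex.
have dcd := dif _ _ cA dA cx dx.
have dde := dif _ _ dA eA dx ex.
have dec : differentiable ((e \o chart_inv d) \o (d \o chart_inv c)) (c x).
  by apply: differentiable_comp => //; rewrite ccx.
apply: etrans (esym (diff_compE u ccx dcd dde)) _.
apply: etrans (esym (deriveE u dec)) _; apply: etrans _ (deriveE u dce).
apply: near_eq_derive; near=> p; rewrite /= chart_mapK//.
near: p; apply: (@chart_inv_continuous _ _ _ c _ cc (chart_dom d)).
by apply: open_nbhs_nbhs; split; [exact: open_chart_dom|rewrite chart_mapK].
Unshelve. all: by end_near. Qed.

(* The tangent vector at [x] with coordinates [u] in the chart [c] (0 if [c]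
   is not a chart at [x]). *)
Definition tvec_fun (x : M) (c : chart R n M) (u : 'rV[R]_n) :
    chart R n M -> 'rV[R]_n :=
  fun d => if `[< chart_at x c /\ chart_at x d >] then transition x c d u else 0.

Lemma tvec_subproof (x : M) (c : chart R n M) (u : 'rV[R]_n) :
  tvec_fun x c u \in tangent_pred x.
Proof.
apply/asboolP; split => [d dx|d e dx ex]; rewrite /tvec_fun.
  by case: asboolP => // -[].
case: asboolP => [[cx _]|ncx].
  by case: asboolP => [_|[]]; rewrite ?transition_trans.
case: asboolP => [[cx _]|_]; first by case: ncx.
by rewrite /transition linear0.
Qed.

Definition tvec (x : M) (c : chart R n M) (u : 'rV[R]_n) : tangent x :=
  Tangent (tvec_subproof x c u).

Lemma tvecK (x : M) (c : chart R n M) (u : 'rV[R]_n) :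
  chart_at x c -> tvec x c u c = u.
Proof.
by move=> cx; rewrite /= /tvec_fun asboolT// transition_id.
Qed.

Lemma tcoordK (x : M) (c : chart R n M) (v : tangent x) :
  chart_at x c -> tvec x c (v c) = v.
Proof.
move=> cx; apply/val_inj/funext => d; rewrite /= /tvec_fun.
have /asboolP[v0 vT] := tcoordP v.
by case: asboolP => [[_ dx]|ndx]; [rewrite -vT|rewrite v0// => dx; apply: ndx].
Qed.

Definition default_chart (x : M) : chart R n M := s2val (cid2 (atlas_cover S x)).

Lemma default_chartP (x : M) : chart_at x (default_chart x).
Proof. by rewrite /default_chart; case: cid2. Qed.

End tangent.

Section maps.
Context {R : realType} {m n : nat} {M N : topologicalType}.
Variables (S : manifold R m M) (T : manifold R n N).

Definition smooth_map (f : M -> N) : Prop :=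
  continuous f /\
  forall c d, atlas S c -> atlas T d ->
    smooth_on [set p | chart_cod c p /\ chart_dom d (f (chart_inv c p))]
              (d \o f \o chart_inv c).

(* The differential of [f] at [x], computed in charts; by [tdiffE] the choice
   of charts is immaterial when [f] is smooth. *)
Definition tdiff (f : M -> N) (x : M) (v : tangent S x) : tangent T (f x) :=
  let c := default_chart S x in
  let d := default_chart T (f x) in
  tvec T (f x) d ('d (d \o f \o chart_inv c) (c x) (v c)).

Lemma tdiffE (f : M -> N) (x : M) (v : tangent S x) c d :
  smooth_map f -> chart_at S x c -> chart_at T (f x) d ->
  tdiff f v d = 'd (d \o f \o chart_inv c) (c x) (v c).
Proof.
move=> [cf sf] cx dx.
have difS c1 c2 : chart_at S x c1 -> chart_at S x c2 ->
    differentiable (c2 \o chart_inv c1) (c1 x).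
  move=> [A1 x1] [A2 x2]; have [+ _] := atlas_smooth A1 A2 1%N; apply.
  by split; [exact: chart_mapP|rewrite chart_mapK].
have difT d1 d2 : chart_at T (f x) d1 -> chart_at T (f x) d2 ->
    differentiable (d2 \o chart_inv d1) (d1 (f x)).
  move=> [A1 x1] [A2 x2]; have [+ _] := atlas_smooth A1 A2 1%N; apply.
  by split; [exact: chart_mapP|rewrite chart_mapK].
have diff1 c1 d1 : chart_at S x c1 -> chart_at T (f x) d1 ->
    differentiable (d1 \o f \o chart_inv c1) (c1 x).
  move=> [A1 x1] [A2 x2]; have [+ _] := sf _ _ A1 A2 1%N; apply.
  by split; [exact: chart_mapP|rewrite chart_mapK].
rewrite /tdiff; set c0 := default_chart S x; set d0 := default_chart T (f x).
have c0x : chart_at S x c0 := default_chartP S x.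
have d0x : chart_at T (f x) d0 := default_chartP T (f x).
rewrite /= /tvec_fun asboolT//.
have /asboolP[_ /(_ c c0 cx c0x) ->] := tcoordP v.
set u := v c; rewrite /transition.
have e1 : (c0 \o chart_inv c) (c x) = c0 x by rewrite /= chart_mapK//; case: cx.
pose f0 := d0 \o f \o chart_inv c0.
have h1 := difS _ _ cx c0x; have h4 := diff1 _ _ cx dx.
have h2 : differentiable f0 (c0 x) := diff1 _ _ c0x d0x.
have h21 : differentiable (f0 \o (c0 \o chart_inv c)) (c x).
  by apply: differentiable_comp => //; rewrite e1.
have e3 : (f0 \o (c0 \o chart_inv c)) (c x) = d0 (f x).
  rewrite -[LHS]/(f0 ((c0 \o chart_inv c) (c x))) e1 /f0 /= chart_mapK//.
  by case: c0x.
have h3 := difT _ _ d0x dx.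
have h321 : differentiable
    ((d \o chart_inv d0) \o (f0 \o (c0 \o chart_inv c))) (c x).
  by apply: differentiable_comp => //; rewrite e3.
rewrite -/f0 -[X in 'd _ _ X](diff_compE u e1 h1 h2).
apply: etrans (esym (diff_compE u e3 h21 h3)) _.
apply: etrans (esym (deriveE u h321)) _; apply: etrans _ (deriveE u h4).
have [cA cx'] := cx; have cc := chart_mapP cx'.
apply: near_eq_derive; near=> p.
have pc0 : chart_dom c0 (chart_inv c p).
  near: p; apply: (@chart_inv_continuous _ _ _ c _ cc (chart_dom c0)).
  apply: open_nbhs_nbhs; split; first exact: open_chart_dom.
  by rewrite chart_mapK//; case: c0x.
have pd0 : chart_dom d0 (f (chart_inv c p)).
  near: p; apply: (@chart_inv_continuous _ _ _ c _ cc (f @^-1` chart_dom d0)).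
  apply: cf; rewrite chart_mapK//.
  by apply: open_nbhs_nbhs; split; [exact: open_chart_dom|case: d0x].
by rewrite /f0 /= (chart_mapK pc0) (chart_mapK pd0).
Unshelve. all: by end_near. Qed.

End maps.
Arguments tdiff {R m n M N} S T f {x} v.

Definition diffeomorphism (R : realType) (m n : nat) (M N : topologicalType)
    (S : manifold R m M) (T : manifold R n N) (f : M -> N) : Prop :=
  smooth_map S T f /\
  exists g : N -> M, [/\ cancel f g, cancel g f & smooth_map T S g].

Definition hessian (R : realType) (n : nat) (f : 'rV[R]_n -> R) (y : 'rV[R]_n) :
    'M[R]_n :=
  \matrix_(i, j) 'D_(delta_mx 0 i) (fun z => 'D_(delta_mx 0 j) f z) y.

Definition positive_definite (R : realType) (n : nat) (A : 'M[R]_n) : Prop :=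
  forall u : 'rV[R]_n, u != 0 -> 0 < (u *m A *m u^T) 0 0.

(* Minkowski norms on R^n.  The notion is invariant under linear changes of
   coordinates, and [finsler] below applies it to T_x M in charts. *)
Record minkowski_norm (R : realType) (n : nat) (F : 'rV[R]_n -> R) : Prop := {
  minkowski_ge0 : forall v, 0 <= F v;
  minkowski_smooth : smooth_on [set v | v != 0] F;
  minkowski_homogeneous : forall (l : R) v, 0 < l -> F (l *: v) = l * F v;
  minkowski_convex : forall y, y != 0 ->
    positive_definite (2^-1 *: hessian (fun v => F v ^+ 2) y)
}.

Section metrics.
Context {R : realType} {n : nat} {M : topologicalType} (S : manifold R n M).

Record finsler (F : forall x : M, tangent S x -> R) : Prop := {
  finsler_smooth : forall c, atlas S c ->
    smooth_on [set q : 'rV[R]_n * 'rV[R]_n | chart_cod c q.1 /\ q.2 != 0]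
              (fun q => F (chart_inv c q.1) (tvec S (chart_inv c q.1) c q.2));
  finsler_minkowski : forall x c, chart_at S x c ->
    minkowski_norm (fun u => F x (tvec S x c u))
}.

Record riemannian (a : forall x : M, tangent S x -> tangent S x -> R) : Prop := {
  riemannian_sym : forall x u v, a x u v = a x v u;
  riemannian_linear : forall x v, scalar (fun u => a x u v);
  riemannian_gt0 : forall x u, u != 0 -> 0 < a x u u;
  riemannian_smooth : forall c, atlas S c -> forall u v : 'rV[R]_n,
    smooth_on (chart_cod c)
      (fun p => a (chart_inv c p) (tvec S (chart_inv c p) c u)
                                  (tvec S (chart_inv c p) c v) : R)
}.

Definition riemannian_norm (a : forall x : M, tangent S x -> tangent S x -> R)
  (x : M) (y : tangent S x) : R := Num.sqrt (a x y y).

Record one_form (b : forall x : M, tangent S x -> R) : Prop := {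
  one_form_linear : forall x, scalar (b x);
  one_form_smooth : forall c, atlas S c -> forall u : 'rV[R]_n,
    smooth_on (chart_cod c)
      (fun p => b (chart_inv c p) (tvec S (chart_inv c p) c u) : R)
}.

(* At [y = 0] the quotient is 0 / 0 = 0, which is F(x, 0). *)
Definition square_metric (a : forall x : M, tangent S x -> tangent S x -> R)
    (b : forall x : M, tangent S x -> R) (x : M) (y : tangent S x) : R :=
  (riemannian_norm a y + b x y) ^+ 2 / riemannian_norm a y.

Definition corresponding_field
    (a : forall x : M, tangent S x -> tangent S x -> R)
    (b : forall x : M, tangent S x -> R) (X : forall x : M, tangent S x) : Prop :=
  forall x (y : tangent S x), a x (X x) y = b x y.

(* [F] is a Finsler metric, or the norm of a Riemannian metric. *)
Definition metric_isometry (F : forall x : M, tangent S x -> R) (f : M -> M) : Prop :=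
  diffeomorphism S S f /\
  forall x (y : tangent S x), F (f x) (tdiff S S f y) = F x y.

Definition preserves_field (X : forall x : M, tangent S x) (f : M -> M) : Prop :=
  forall x, tdiff S S f (X x) = X (f x).

End metrics.

#[short(type="topGroupType")]
HB.structure Definition TopGroup := {G of Group G & Topological G}.

(* [mul_smooth] states smoothness of the product on G x G in the charts of the
   product manifold. *)
Record lie_group (R : realType) (n : nat) (G : topGroupType)
    (S : manifold R n G) : Prop := {
  mul_continuous : continuous (fun q : G * G => (q.1 * q.2)%g);
  mul_smooth : forall c d e, atlas S c -> atlas S d -> atlas S e ->
    smooth_on [set q : 'rV[R]_n * 'rV[R]_n |
                [/\ chart_cod c q.1, chart_cod d q.2 &
                    chart_dom e (chart_inv c q.1 * chart_inv d q.2)%g]]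
              (fun q => e (chart_inv c q.1 * chart_inv d q.2)%g);
  inv_smooth : smooth_map S S (fun g : G => g^-1%g)
}.

Section cosets.
Context {G : topGroupType} (H : groupClosed G).

Definition coset_rel : rel G := fun x y => (x^-1 * y)%g \in H.

Lemma coset_rel_equiv : equiv_class_of coset_rel.
Proof.
split.
- by move=> x; rewrite /coset_rel mulVg gpred1.
- by move=> x y; rewrite /coset_rel -gpredV invgM invgK.
- move=> y x z xy yz; rewrite /coset_rel.
  by rewrite -[z](mulVKg y) mulgA gpredM.
Qed.

Canonical coset_equiv := EquivRelPack coset_rel_equiv.

(* The space G/H of left cosets xH, with the quotient topology. *)
Definition cosets : topologicalType := quotient_topology {eq_quot coset_equiv}.

Definition coset_pi (x : G) : cosets :=
  \pi_(quotient_topology {eq_quot coset_equiv}) x.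

Definition left_translation (g : G) (q : cosets) : cosets :=
  coset_pi (g * repr (q : quotient_topology {eq_quot coset_equiv}))%g.

Lemma coset_piP (x y : G) :
  coset_pi x = coset_pi y <-> (x^-1 * y)%g \in H.
Proof.
rewrite -[(_ * _)%g \in H]/(coset_equiv x y).
rewrite -(@pi_eq_quot _ _ {eq_quot coset_equiv}) /coset_pi.
by split => [xy|/eqP//]; apply/eqP.
Qed.

Lemma left_translationE (g x : G) :
  left_translation g (coset_pi x) = coset_pi (g * x)%g.
Proof.
apply/coset_piP; rewrite invgM -mulgA mulKg; apply/coset_piP.
exact: (@reprK _ (quotient_topology {eq_quot coset_equiv})).
Qed.

End cosets.

(* The canonical smooth structure of G/H: the unique one for which the
   projection from G is a smooth submersion. *)
Definition homogeneous_structure (R : realType) (m n : nat) (G : topGroupType)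
    (S : manifold R m G) (H : groupClosed G) (T : manifold R n (cosets H)) : Prop :=
  smooth_map S T (@coset_pi G H) /\
  forall (x : G) (w : tangent T (coset_pi H x)),
    exists v : tangent S x, tdiff S T (@coset_pi G H) v = w.

(* Main.v *)
Require Import Defs.
From mathcomp Require Import all_boot all_order all_algebra.
From mathcomp Require Import all_classical all_reals all_analysis.
From mathcomp Require Import ring lra.

Set Implicit Arguments.
Unset Strict Implicit.
Unset Printing Implicit Defensive.

Import Order.TTheory GRing.Theory Num.Theory.
Import numFieldNormedType.Exports.

Local Open Scope classical_set_scope.
Local Open Scope ring_scope.

(** Let L be the differential at x of the translation by g.  It is linear, and
    F (L y) = F y.  Since F = alpha + 2 beta + beta^2 / alpha, with alpha even
    and beta odd, comparing the values at y and at - y gives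
    beta (L y) = beta y, and then r + t^2 / r = r' + t^2 / r' for r = alpha y,
    r' = alpha (L y) and t = beta y; hence r = r' or r * r' = t^2
    ([square_ratio_eq]).

    In the second case with r != r', |t| lies strictly between r and r', so
    q = alpha^2 - beta^2 has opposite signs at y and at L y.  This is what has
    to be excluded.  It cannot be excluded pointwise: on a line, the Minkowski
    norms of the pairs (alpha, beta) = (1, 2) and (4, 2) coincide.  The argument
    is global:

    - F is positive on nonzero vectors ([minkowski_gt0]), hence so are
      (alpha + beta)^2 and (alpha - beta)^2, and q vanishes on no nonzero
      vector ([gap_form_neq0]);
    - an indefinite quadratic form has a nonzero isotropic vector
      ([indefinite_isotropic]), so q has a constant sign on each tangent space;
    - each of the two signs occurs on an open set of points
      ([open_exists_gt0]), and G/H is connected, being a continuous image of G,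
      so the sign is the same at all points ([gap_form_sign]).

    Thus alpha (L y) = alpha y, and by polarization L preserves the inner
    product ([isometry_inner]).  For the field, write X and X' for its values at
    x and g x.  Since <X', L X> = beta (L X) = beta X = <X, X>, expanding gives
    |X' - L X|^2 = |X'|^2 - |X|^2.  So |X| <= |X'|, and the inverse translation
    gives the opposite inequality; therefore X' = L X. *)

(** * Positivity of Minkowski norms *)

Lemma derive_at_zero_min (R : realType) (V : normedModType R) (f : V -> R)
    (y v : V) :
  (forall z, 0 <= f z) -> f y = 0 -> differentiable f y -> 'D_v f y = 0.
Proof.
move=> f0 fy df.
have D_ge0 w : 0 <= 'D_w f y.
  have : derivable f y w by exact: diff_derivable.
  rewrite /derivable => cf.
  have right_sub : (0 : R)^'+ --> (0 : R)^'.
    by apply: within_subset => h /= h0; rewrite gt_eqF.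
  have cr := cvg_trans (cvg_app _ right_sub) cf.
  rewrite /derive -(cvg_lim _ cr)//.
  apply: limr_ge; first exact: cvgP cr.
  near=> h; rewrite /= fy subr0 mulr_ge0// invr_ge0 ltW//.
apply/eqP; rewrite eq_le D_ge0 andbT -oppr_ge0.
by rewrite deriveE// -linearN -deriveE.
Unshelve. all: by end_near. Qed.

(** At a zero y of F the differential of F vanishes, as y is a minimum.  Every
    term of the second derivative of F^2 contains F or a first derivative of F
    as a factor, so the Hessian of F^2 at y is 0, against convexity. *)
Lemma minkowski_gt0 (R : realType) (n : nat) (F : 'rV[R]_n -> R) (y : 'rV[R]_n) :
  minkowski_norm F -> y != 0 -> 0 < F y.
Proof.
move=> mF y0; rewrite lt_neqAle minkowski_ge0// andbT eq_sym.
apply/eqP => Fy.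
have [dF CdF] := minkowski_smooth mF 2.
have DF0 v : 'D_v F y = 0.
  by apply: derive_at_zero_min => //; [exact: minkowski_ge0|exact: dF].
have := minkowski_convex mF y0 y0.
suff -> : hessian (fun v => F v ^+ 2) y = 0.
  by rewrite scaler0 mulmx0 mul0mx mxE ltxx.
apply/matrixP => i j; rewrite !mxE.
set u := delta_mx 0 i; set v := delta_mx 0 j.
have DFu : derivable ('D_v F) y u.
  by have [+ _] := CdF v; move=> /(_ y y0) /diff_derivable.
have Fu : derivable F y u by exact/diff_derivable/dF.
have nz_open : open [set z : 'rV[R]_n | z != 0].
  rewrite (_ : [set _ | _] = ~` [set 0]); last first.
    by apply/seteqP; split => z /eqP.
  apply/closed_openC/accessible_closed_set1/hausdorff_accessible.
  exact: norm_hausdorff.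
have nz : \forall z \near y, z != 0 by exact: open_nbhs_nbhs.
rewrite (@near_eq_derive _ _ _ _ ((2%:R : R) \*: (F * 'D_v F))).
  rewrite deriveZ; last exact: derivableM.
  by rewrite deriveM// DF0 Fy !scale0r addr0 scaler0.
near=> z.
have z0 : z != 0 by near: z.
have Fv : derivable F z v by exact/diff_derivable/dF.
rewrite (_ : (fun _ => _) = F * F); last by apply/funext => w; rewrite expr2.
by rewrite deriveM//= -mulr2n -scaler_nat.
Unshelve. all: by end_near. Qed.

(** * Linear algebra *)

Lemma linear_fun0 (R : pzRingType) (U V : lmodType R) (f : U -> V) :
  linear f -> f 0 = 0.
Proof. by move/(_ (-1) 0 0); rewrite scaler0 addr0 scaleN1r addNr. Qed.

Section forms.
Context {R : realType} {V : lmodType R}.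

Lemma scalar_fun0 (f : V -> R) : scalar f -> f 0 = 0.
Proof. exact: (@linear_fun0 R V R^o). Qed.

Lemma form_line (q : V -> V -> R) (y z : V) (s : R) :
  (forall u v, q u v = q v u) -> (forall v, scalar (fun u => q u v)) ->
  q (s *: z + y) (s *: z + y) = s ^+ 2 * q z z + 2 * s * q y z + q y y.
Proof.
move=> qC qL; rewrite qL !(qC _ (s *: z + y)) !qL (qC z y); ring.
Qed.

(** The quadratic polynomial s |-> q (s z + y) has a negative constant term and
    a positive leading coefficient, hence a real root s; and s z + y != 0,
    because q (- s z) >= 0 > q y. *)
Lemma indefinite_isotropic (q : V -> V -> R) (y z : V) :
  (forall u v, q u v = q v u) -> (forall v, scalar (fun u => q u v)) ->
  q y y < 0 -> 0 < q z z -> exists2 w, w != 0 & q w w = 0.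
Proof.
move=> qC qL y0 z0.
have D0 : 0 <= q y z ^+ 2 - q z z * q y y by nra.
(* the larger root of q z z * s ^+ 2 + 2 * q y z * s + q y y *)
pose s := (Num.sqrt (q y z ^+ 2 - q z z * q y y) - q y z) / q z z.
have sE : q z z * s + q y z = Num.sqrt (q y z ^+ 2 - q z z * q y y).
  by rewrite /s mulrC divfK ?subrK ?gt_eqF.
have ssE : (q z z * s + q y z) ^+ 2 = q y z ^+ 2 - q z z * q y y.
  by rewrite sE sqr_sqrtr.
exists (s *: z + y); last by rewrite form_line//; nra.
apply/eqP => w0; have yE : y = - s *: z + 0.
  by rewrite addr0 scaleNr; apply/eqP; rewrite -addr_eq0 addrC w0.
have q0 v : q 0 v = 0.
  exact: scalar_fun0 (qL v).
have : q y y = s ^+ 2 * q z z.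
  by rewrite {1 2}yE form_line// !q0 sqrrN mulr0 !addr0.
by nra.
Qed.

End forms.

(** (r + t)^2 / r = r + 2 t + t^2 / r; the odd parts in t give t = t', and the
    even parts give (r - r') (r r' - t^2) = 0. *)
Lemma square_ratio_eq (R : realFieldType) (r t r' t' : R) :
  0 < r -> 0 < r' ->
  (r + t) ^+ 2 / r = (r' + t') ^+ 2 / r' ->
  (r - t) ^+ 2 / r = (r' - t') ^+ 2 / r' ->
  t = t' /\ (r = r' \/ r * r' = t ^+ 2).
Proof.
move=> r0 r0' e1 e2.
have E (p s : R) : 0 < p -> (p + s) ^+ 2 / p = p + 2 * s + s ^+ 2 / p.
  by move=> p0; field; rewrite gt_eqF.
have tt' : t = t'.
  move: e1 e2; rewrite !E//.
  by rewrite !sqrrN; lra.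
subst t'; split => //.
have : (r - r') * (r * r' - t ^+ 2) = 0.
  move: e1; rewrite !E// => e1.
  have e3 : r - r' = t ^+ 2 / r' - t ^+ 2 / r by lra.
  rewrite mulrBr {1}e3; field; lra.
by move/eqP; rewrite mulf_eq0 !subr_eq0 => /orP[] /eqP; [left|right].
Qed.

(** * Functions on the tangent spaces *)

Lemma tvec_linear (R : realType) (n : nat) (M : topologicalType)
    (S : manifold R n M) (x : M) (c : chart R n M) : linear (tvec S x c).
Proof.
move=> k u v; apply/val_inj/funext => d.
rewrite -[RHS]/(k *: tvec_fun S x c u d + tvec_fun S x c v d) /= /tvec_fun.
by case: ifP => _; rewrite ?scaler0 ?addr0// /transition linearP.
Qed.

Lemma tdiff_linear (R : realType) (m n : nat) (M N : topologicalType)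
    (S : manifold R m M) (T : manifold R n N) (f : M -> N) (x : M) :
  linear (@tdiff _ _ _ _ _ S T f x).
Proof. by move=> k u v; rewrite /tdiff -tvec_linear -linearP. Qed.

Section tangent_topology.
Context {R : realType} {n : nat} {M : topologicalType}.
Variable S : manifold R n M.

Lemma tvec_eq0 (x : M) (c : chart R n M) (u : 'rV[R]_n) :
  chart_at S x c -> (tvec S x c u == 0) = (u == 0).
Proof.
move=> cx; apply/eqP/eqP => [e|->]; last first.
  exact/linear_fun0/tvec_linear.
by rewrite -(tvecK u cx) e.
Qed.

Lemma continuous_in_chart (h : M -> R) (x : M) (c : chart R n M) :
  chart_dom c x -> {for c x, continuous (h \o chart_inv c)} ->
  {for x, continuous h}.
Proof.
move=> cx hc; have cc := chart_map_continuous cx.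
have := continuous_comp cc hc.
rewrite /prop_for /continuous_at /= chart_mapK//; apply: cvg_trans.
apply: near_eq_cvg; near=> z; rewrite /= chart_mapK//.
by near: z; apply: open_nbhs_nbhs; split => //; exact: open_chart_dom.
Unshelve. all: by end_near. Qed.

(** A vector with h > 0 is extended to nearby points with constant coordinates
    in a chart; h stays positive on it by continuity. *)
Lemma open_exists_gt0 (h : forall x : M, tangent S x -> R) :
  (forall (c : chart R n M) (u : 'rV[R]_n), atlas S c ->
     forall p, chart_cod c p ->
     {for p, continuous (fun p => h (chart_inv c p) (tvec S (chart_inv c p) c u))}) ->
  open [set x | exists y : tangent S x, 0 < h x y].
Proof.
move=> hc; rewrite openE => x [y y0]; rewrite /interior.
pose c := default_chart S x.
have [cA cx] : chart_at S x c := default_chartP S x.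
have hx : {for x, continuous (fun z => h z (tvec S z c (y c)))}.
  by apply: (@continuous_in_chart _ _ c) => //; apply: hc => //; exact: chart_mapP.
have : \forall z \near x, 0 < h z (tvec S z c (y c)).
  by apply: (cvgr_gt _ hx); rewrite tcoordK.
by apply: filterS => z hz; exists (tvec S z c (y c)).
Qed.

(** The polar form of alpha^2 - beta^2. *)
Definition gap_form (a : forall x : M, tangent S x -> tangent S x -> R)
    (b : forall x : M, tangent S x -> R) (x : M) (u v : tangent S x) : R :=
  a x u v - b x u * b x v.

Arguments gap_form a b {x} u v.

(** The points where the form takes a positive value and those where it takes a
    negative value are two disjoint open sets covering M; disjointness holds
    because a nonvanishing form is not indefinite. *)
Lemma gap_form_sign (a : forall x : M, tangent S x -> tangent S x -> R)
    (b : forall x : M, tangent S x -> R) (x x' : M) (y : tangent S x)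
    (y' : tangent S x') :
  connected [set: M] -> riemannian a -> one_form b ->
  (forall z (w : tangent S z), w != 0 -> gap_form a b w w != 0) ->
  ~ (gap_form a b y y < 0 /\ 0 < gap_form a b y' y').
Proof.
move=> Mconn ha hb q0 [qy qy'].
have qC z (u v : tangent S z) : gap_form a b u v = gap_form a b v u.
  by rewrite /gap_form riemannian_sym// mulrC.
have qL z (v : tangent S z) : scalar (fun u => gap_form a b u v).
  move=> k u w; rewrite /gap_form (riemannian_linear ha) (one_form_linear hb).
  ring.
pose P := [set z | exists w : tangent S z, 0 < gap_form a b w w].
pose N := [set z | exists w : tangent S z, 0 < - gap_form a b w w].
have qcont c (u : 'rV[R]_n) : atlas S c -> forall p, chart_cod c p ->
    {for p, continuous (fun p => gap_form a b (tvec S (chart_inv c p) c u)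
                                              (tvec S (chart_inv c p) c u))}.
  move=> cA p cp.
  have ca := riemannian_smooth ha cA u u 0%N _ cp.
  have cb := one_form_smooth hb cA u 0%N _ cp.
  by apply: continuousB => //; exact: continuousM.
have Popen : open P by exact: open_exists_gt0.
have Nopen : open N.
  by apply: open_exists_gt0 => c u cA p cp; apply: continuousN; exact: qcont.
have PN z : P z -> N z -> False.
  move=> [w w0] [v]; rewrite oppr_gt0 => qv.
  have [t t0 /eqP] := indefinite_isotropic (qC z) (qL z) qv w0.
  exact/negP/q0.
(* The existence of y makes the dimension positive: its coordinates, read in
   a chart at z, are a nonzero vector at z. *)
have y0 : y != 0.
  apply/eqP => y0; move: qy.
  by rewrite y0 (scalar_fun0 (qL x 0)) ltxx.
have yc0 : y (default_chart S x) != 0.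
  by rewrite -(tvec_eq0 _ (default_chartP S x)) tcoordK//; exact: default_chartP.
have PUN z : P z \/ N z.
  have cz := default_chartP S z.
  have w0 : tvec S z (default_chart S z) (y (default_chart S x)) != 0.
    by rewrite tvec_eq0.
  have /lt_total /orP[] := q0 _ _ w0 => h; [right|left]; eexists; rewrite ?oppr_gt0; exact: h.
have PT : P = setT.
  apply: Mconn; first by exists x', y'.
  - by exists P => //; rewrite setTI.
  - exists (~` N); first exact: open_closedC.
    rewrite setTI; apply/seteqP; split => z; first by move=> Pz /(PN z Pz).
    by case: (PUN z).
by apply: (PN x); [rewrite PT|exists y; rewrite oppr_gt0].
Qed.

End tangent_topology.
Arguments gap_form {R n M S} a b {x} u v.

(** * The homogeneous space G/H *)

Lemma cosets_connected (G : topGroupType) (H : groupClosed G) :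
  connected [set: G] -> connected [set: cosets H].
Proof.
move=> Gconn; have -> : [set: cosets H] = coset_pi H @` setT.
  apply/seteqP; split => // q _; exists (repr q) => //; exact: reprK.
apply: connected_continuous_connected => //; apply: continuous_subspaceT.
exact: pi_continuous.
Qed.

Lemma left_translationK (G : topGroupType) (H : groupClosed G) (g : G) :
  cancel (left_translation (H := H) g) (left_translation g^-1%g).
Proof.
move=> q; rewrite -[q]reprK; rewrite -/(coset_pi H (repr q)).
by rewrite !left_translationE mulKg.
Qed.

(** * Isometries of a square metric *)

Section isometry.
Context {R : realType} {n : nat} {M : topologicalType} {S : manifold R n M}.
Variables (a : forall x : M, tangent S x -> tangent S x -> R).
Variables (b : forall x : M, tangent S x -> R).
Arguments a : clear implicits.
Arguments b : clear implicits.
Hypotheses (ha : riemannian a) (hb : one_form b).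
Hypothesis hF : finsler (square_metric a b).

Let aC x (u v : tangent S x) : a x u v = a x v u.
Proof. exact: riemannian_sym. Qed.

Let aL x (v : tangent S x) : scalar (fun u => a x u v).
Proof. exact: riemannian_linear. Qed.

Let bL x : scalar (b x).
Proof. exact: one_form_linear. Qed.

Let bN x (y : tangent S x) : b x (- y) = - b x y.
Proof.
have := bL (-1) y 0.
by rewrite addr0 scaleN1r mulN1r (scalar_fun0 (@bL x)) addr0.
Qed.

Let aZ x k (y : tangent S x) : a x (k *: y) (k *: y) = k ^+ 2 * a x y y.
Proof.
have aZl w z : a x (k *: w) z = k * a x w z.
  have := aL z k w 0; rewrite /= (scalar_fun0 (aL z)).
  by rewrite !addr0.
by rewrite aZl aC aZl mulrA -expr2.
Qed.

Let alpha_gt0 x (y : tangent S x) : y != 0 -> 0 < riemannian_norm a y.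
Proof. by move=> y0; rewrite sqrtr_gt0 riemannian_gt0. Qed.

Let alphaN x (y : tangent S x) : riemannian_norm a (- y) = riemannian_norm a y.
Proof. by rewrite /riemannian_norm -scaleN1r aZ sqrrN expr1n mul1r. Qed.

Let alpha0 x : riemannian_norm a (0 : tangent S x) = 0.
Proof. by rewrite /riemannian_norm -(scale0r 0) aZ expr0n mul0r sqrtr0. Qed.

Let alpha_sqr x (y : tangent S x) : riemannian_norm a y ^+ 2 = a x y y.
Proof.
rewrite sqr_sqrtr//; have [->|y0] := eqVneq y 0; last exact/ltW/riemannian_gt0.
by rewrite -(scale0r (0 : tangent S x)) aZ expr0n mul0r.
Qed.

Lemma square_metric_gt0 x (y : tangent S x) : y != 0 -> 0 < square_metric a b y.
Proof.
move=> y0; have cx := default_chartP S x.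
rewrite -[y](tcoordK y cx).
apply: (minkowski_gt0 (finsler_minkowski hF cx)).
by rewrite -(tvec_eq0 _ cx) tcoordK.
Qed.

(** alpha^2 - beta^2 = (alpha - beta) (alpha + beta), and the two factors are
    nonzero because F (- y) and F y are. *)
Lemma gap_form_neq0 x (y : tangent S x) : y != 0 -> gap_form a b y y != 0.
Proof.
move=> y0; have yN0 : - y != 0 by rewrite oppr_eq0.
have := square_metric_gt0 y0; have := square_metric_gt0 yN0.
rewrite /square_metric alphaN bN /gap_form -alpha_sqr -expr2 subr_sqr => Fm Fp.
rewrite mulf_neq0//.
  by apply/eqP => e; move: Fm; rewrite e expr0n mul0r ltxx.
by apply/eqP => e; move: Fp; rewrite e expr0n mul0r ltxx.
Qed.

Variable f : M -> M.
Hypothesis Mconn : connected [set: M].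
Hypothesis fF : metric_isometry (square_metric a b) f.

Let df x : tangent S x -> tangent S (f x) := tdiff S S f.

Let df0 x : df (0 : tangent S x) = 0.
Proof. exact/linear_fun0/tdiff_linear. Qed.

Let dfN x (y : tangent S x) : df (- y) = - df y.
Proof.
have := @tdiff_linear _ _ _ _ _ S S f x (-1) y 0.
by rewrite -!/(df _) df0 !addr0 !scaleN1r.
Qed.

(** [square_ratio_eq] leaves the alternative that alpha (df y) * alpha y =
    beta y ^+ 2; if the two norms differ, it makes alpha^2 - beta^2 negative at
    one of y, df y and positive at the other, against [gap_form_sign]. *)
Lemma isometry_form_norm x (y : tangent S x) :
  b (f x) (df y) = b x y /\ riemannian_norm a (df y) = riemannian_norm a y.
Proof.
have [->|y0] := eqVneq y 0.
  by rewrite df0 !alpha0 !(scalar_fun0 (@bL _)).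
have Ff z (w : tangent S z) : square_metric a b (df w) = square_metric a b w.
  exact: fF.2.
have dy0 : df y != 0.
  apply: contraTneq (square_metric_gt0 y0) => e.
  by rewrite -Ff e /square_metric alpha0 invr0 mulr0 ltxx.
have e1 := Ff _ y; have e2 := Ff _ (- y).
rewrite /square_metric dfN !alphaN !bN in e1 e2.
have [tt' [//|rr']] := square_ratio_eq (alpha_gt0 dy0) (alpha_gt0 y0) e1 e2.
split => //.
have s1 := gap_form_sign (y := y) (y' := df y) Mconn ha hb gap_form_neq0.
have s2 := gap_form_sign (y := df y) (y' := y) Mconn ha hb gap_form_neq0.
rewrite /gap_form -!alpha_sqr -!expr2 -tt' -rr' in s1 s2.
have r0 := alpha_gt0 y0; have r0' := alpha_gt0 dy0.
have [lt|lt|//] := ltgtP (riemannian_norm a (df y)) (riemannian_norm a y).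
- by case: s2; split; nra.
- by case: s1; split; nra.
Qed.

Lemma isometry_inner x (u v : tangent S x) : a (f x) (df u) (df v) = a x u v.
Proof.
have N w : a (f x) (df w) (df w) = a x w w.
  by rewrite -!alpha_sqr (isometry_form_norm w).2.
have := N (1 *: u + v).
rewrite /df tdiff_linear -!/(df _) !form_line ?N//.
all: try exact: aC; try exact: aL.
rewrite (aC v u) (aC (df v) (df u)).
lra.
Qed.

End isometry.

(** * Invariance of the Riemannian metric and of the field *)

Unset Implicit Arguments.

Theorem theorem3p1 (R : realType) (m n : nat)
  (G : topGroupType) (SG : manifold R m G) (hG : lie_group SG)
  (Gconn : connected [set: G])
  (H : groupClosed G) (Hclosed : closed [set h : G | h \in H])
  (SM : manifold R n (cosets H)) (hM : homogeneous_structure SG SM)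
  (a : forall x : cosets H, tangent SM x -> tangent SM x -> R)
  (ha : riemannian a)
  (b : forall x : cosets H, tangent SM x -> R) (hb : one_form b)
  (F : forall x : cosets H, tangent SM x -> R) (hF : finsler F)
  (Fsquare : forall (x : cosets H) (y : tangent SM x),
     F x y = square_metric a b y)
  (Finv : forall g : G, metric_isometry F (left_translation (H := H) g))
  (X : forall x : cosets H, tangent SM x)
  (hX : corresponding_field a b X) :
  (forall g : G, metric_isometry (riemannian_norm a) (left_translation (H := H) g)) /\
  (forall g : G, preserves_field X (left_translation (H := H) g)).
Proof.
have Mconn : connected [set: cosets H] by exact: cosets_connected.
have FE : F = square_metric a b.
  by apply: functional_extensionality_dep => x; apply/funext => y.
subst F.
have inner g x (u v : tangent SM x) := isometry_inner ha hb hF Mconn (Finv g) u v.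
have aL x (v : tangent SM x) : scalar (fun u => a x u v).
  exact: riemannian_linear.
split => [g|].
  split; first by case: (Finv g).
  by move=> x y; rewrite /riemannian_norm inner.
pose d g x := tdiff SM SM (left_translation (H := H) g) (X x).
(* The cross term is <X', dX> = beta (dX) = beta X = <X, X>. *)
have distE g x : a _ (X (left_translation g x) - d g x) (X (left_translation g x) - d g x)
    = a _ (X (left_translation g x)) (X (left_translation g x)) - a x (X x) (X x).
  have aX : a _ (X (left_translation g x)) (d g x) = a x (X x) (X x).
    by rewrite !hX (isometry_form_norm ha hb hF Mconn (Finv g) (X x)).1.
  rewrite (_ : X _ - d g x = -1 *: d g x + X _); last by rewrite scaleN1r addrC.
  rewrite (form_line (q := a _)); last 2 first.
  - exact: riemannian_sym.
  - exact: riemannian_linear.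
  rewrite inner aX; ring.
have ge0 x (y : tangent SM x) : 0 <= a x y y.
  have [->|y0] := eqVneq y 0; last exact/ltW/riemannian_gt0.
  by rewrite (scalar_fun0 (aL x 0)).
have mono g x : a x (X x) (X x) <= a _ (X (left_translation g x)) (X (left_translation g x)).
  by rewrite -subr_ge0 -distE.
move=> g x; apply/eqP; rewrite eq_sym -subr_eq0.
apply/negPn/negP => /(riemannian_gt0 ha); rewrite distE subr_gt0 ltNge => /negP; apply.
by have := mono g^-1%g (left_translation g x); rewrite left_translationK.
Qed.
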